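(* Let $q_f\approx 1.75488$ be the real root of $x^3=2x^2-x+1$. For every integer $k\ge 3$, the smallest element of $\mathcal{B}_k$ is $q_f$; that is, $q_f\in\mathcal{B}_k$ and $q\ge q_f$ for all $q\in\mathcal{B}_k$.
   Context: For $q\in(1,2)$ let $I_q=[0,\frac{1}{q-1}]$. For $x\in I_q$, a $q$-expansion of $x$ is a sequence $(\epsilon_i)_{i=1}^\infty\in\{0,1\}^{\mathbb{N}}$ with $x=\sum_{i=1}^\infty \epsilon_i q^{-i}$, and $\Sigma_q(x)$ denotes the set of all $q$-expansions of $x$. For $k\in\mathbb{N}$, $\mathcal{B}_k=\{q\in(1,2) : \text{there exists } x\in(0,\frac{1}{q-1}) \text{ with } \#\Sigma_q(x)=k\}$. *)

(* Defs.v *)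
From HB Require Import structures.
From mathcomp Require Import all_boot all_order all_algebra.
From mathcomp Require Import ring lra.
From mathcomp Require Import all_classical all_reals all_analysis.

Set Implicit Arguments.
Unset Strict Implicit.
Unset Printing Implicit Defensive.

Import Order.TTheory GRing.Theory Num.Theory.
Import numFieldNormedType.Exports.
Local Open Scope classical_set_scope.
Local Open Scope card_scope.
Local Open Scope ring_scope.

(* A digit sequence is indexed from 0: [e i] is the digit $\epsilon_{i+1}$,
   hence the exponent [i.+1]. *)
Definition q_expansions (R : realType) (q x : R) : set (nat -> bool) :=
  [set e : nat -> bool | series (fun i : nat => (e i)%:R * q ^- i.+1) @ \oo --> x].

Definition calB (R : realType) (k : nat) : set R :=
  [set q | 1 < q < 2 /\
     exists x : R, 0 < x < (q - 1)^-1 /\ q_expansions q x #= `I_k].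
Arguments calB R k : clear implicits.

Definition q_f_eq (R : realType) (x : R) : Prop :=
  x ^+ 3 = 2 * x ^+ 2 - x + 1.

(* The default value 0 of [xget] is never used: see [q_fP]. *)
Definition q_f (R : realType) : R := xget 0 [set x : R | q_f_eq x].

Lemma q_f_eq_gt (R : realType) (x : R) : q_f_eq x -> 1 < x.
Proof.
rewrite /q_f_eq => hx; rewrite ltNge; apply/negP => x1.
have h : x * (x - 1) ^+ 2 = 1 by ring: hx.
have [x0|x0] := leP x 0.
  have : x * (x - 1) ^+ 2 <= 0 by rewrite mulr_le0_ge0// sqr_ge0.
  by rewrite h ler10.
have : x * (x - 1) ^+ 2 < 1 by nra.
by rewrite h ltxx.
Qed.

Lemma q_f_eq_inj (R : realType) (x y : R) : q_f_eq x -> q_f_eq y -> x = y.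
Proof.
move=> hx hy; have x1 := q_f_eq_gt hx; have y1 := q_f_eq_gt hy.
have h : (x - y) * (x ^+ 2 + x * y + y ^+ 2 - 2 * (x + y) + 1) = 0.
  by move: hx hy; rewrite /q_f_eq => hx hy; ring: hx hy.
move/eqP: h; rewrite mulf_eq0 subr_eq0 => /orP[/eqP//|/eqP h]; exfalso; nra.
Qed.

Lemma q_f_eq_ex (R : realType) :
  exists x : R, 1754 / 1000 <= x <= 1755 / 1000 /\ q_f_eq x.
Proof.
pose p : {poly R} := 'X ^+ 3 - 2 *: 'X ^+ 2 + 'X - 1.
have pE x : p.[x] = x ^+ 3 - 2 * x ^+ 2 + x - 1 by rewrite /p !hornerE.
have ab : 1754 / 1000 <= 1755 / 1000 :> R by lra.
have [|x] := @poly_ivt R p _ _ ab.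
- by rewrite !pE; apply/andP; split; lra.
by move=> xab /rootP; rewrite pE => h; exists x; split=> //; rewrite /q_f_eq; lra.
Qed.

Lemma q_fP (R : realType) : q_f_eq (q_f R).
Proof.
have [x [_ hx]] := q_f_eq_ex R.
exact: (@xgetPex _ 0 [set x : R | q_f_eq x] (ex_intro _ x hx)).
Qed.

Lemma q_f_unique (R : realType) (x : R) : q_f_eq x -> x = q_f R.
Proof. by move=> hx; exact: q_f_eq_inj hx (q_fP R). Qed.

Lemma q_f_approx (R : realType) : 1754 / 1000 <= q_f R <= 1755 / 1000.
Proof. by have [x [h /q_f_unique <-]] := q_f_eq_ex R. Qed.

(* Main.v *)
Require Import Defs.
From mathcomp Require Import all_boot all_order all_algebra.
From mathcomp Require Import finmap ring lra zify.
From mathcomp Require Import all_classical all_reals all_analysis.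

Import Order.TTheory GRing.Theory Num.Theory.
Import numFieldNormedType.Exports.
Local Open Scope classical_set_scope.
Local Open Scope card_scope.
Local Open Scope ring_scope.

(** Write [V = 1 / (q - 1)] and call [q * x] and [q * x - 1] the children of
    [x]. The number of expansions of [x] is the sum of those of its children,
    and it is zero outside [[0, V]] and positive inside ([card_expansionsD],
    [card_expansions_out], [card_expansions_in]). So [x] branches exactly when
    [1 <= q * x <= V], and elsewhere its first digit is forced. Throughout,
    [s = 1 / q] and [c = 1 / (q ^ 2 - 1)], the point with digits [(01)^oo].

    Lower bound. Suppose that [q < q_f] and that some point has [k >= 3]
    expansions. Going down its tree of expansions ([branch_point_small]) one
    finds a branch point whose children have one or two expansions each, not
    both one, and also a branch point whose children both have exactly one.
    If [z] is a branch point, then [v = q * z - 1] and [u = V - q * z] satisfy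
    [u + v = V - 1], and [u] has as many expansions as the child [q * z] by
    reflection. This gives one equation for each kind of branch point, once the
    small points with one or two expansions are known.

    These are found from a trapping property of the bases up to [q_f]
    ([orbit_trap]): without branching, an orbit between [V - 1] and 1 can only
    alternate the digits 0 and 1, and this is a map expanding distances to [c].
    So small univoque points are [c * s ^ m] with [m >= 1] ([few1_small]), and
    the equation for two univoque children becomes
    [s ^ m + s ^ n = (2 - q) * (q + 1)], which below [q_f] forces
    [{m, n} = {1, 3}] and [q ^ 4 = 2 * q ^ 2 + q + 1] ([few1_pair]). For that
    single base, the two branch points are explicit and small points with at
    most two expansions are [c * s ^ m * l], where [l - 1] is 0 or
    [(q - 1) * (- s) ^ j] with [j >= 2] ([few2_small]). The equation
    [s ^ m * l + s ^ n * l' = s + s ^ 3] then has only the solution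
    [l = l' = 1], by size except for [{m, n} = {1, 3}], where the signs of the
    powers of [- s] exclude the others ([few2_pair]). So both children have one
    expansion, a contradiction.

    Attainment. In base [q_f] one has [1 = s + s ^ 2 + s ^ 4], that is, the
    digits 10000 may be replaced by 01101. Applied to
    [1 (0000)^(k-1) (01)^oo], this leaves after the first digit 0 the forced
    digits 110 and then [1 (0000)^(k-2) (01)^oo], while the first digit 1 leaves
    a univoque point; by induction the point has exactly [k] expansions
    ([card_ladder]). *)

Set Implicit Arguments.
Unset Strict Implicit.
Unset Printing Implicit Defensive.

(** * The tree of expansions *)

Definition cons_digit (d : bool) (e : nat -> bool) : nat -> bool :=
  fun n => if n is m.+1 then e m else d.

Definition tail_digits (e : nat -> bool) : nat -> bool := fun n => e n.+1.

Lemma cons_digit_inj d : injective (cons_digit d).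
Proof. by move=> e e' h; apply/funext => n; have := congr1 (@^~ n.+1) h. Qed.

Lemma cons_tail e : cons_digit (e 0%N) (tail_digits e) = e.
Proof. by apply/funext => -[]. Qed.

Lemma card_cons_digits {A B : set (nat -> bool)} {a b : nat} :
  A #= `I_a -> B #= `I_b ->
  cons_digit false @` A `|` cons_digit true @` B #= `I_(a + b).
Proof.
move=> hA hB.
have fA : finite_set A by exists a.
have fB : finite_set B by exists b.
rewrite -(fset_setK fA) -(fset_setK fB) in hA hB *.
move: (fset_set A) (fset_set B) hA hB => FA FB /card_eq_fsetP <- /card_eq_fsetP <-.
pose F := ((cons_digit false @` FA) `|` (cons_digit true @` FB))%fset.
rewrite (_ : _ `|` _ = [set` F]); last first.
  apply/seteqP; split => e /=.
    rewrite inE; case=> -[e' h <-]; apply/orP; [left|right]; exact: in_imfset.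
  by rewrite inE => /orP[] /imfsetP[e' /= h ->]; [left|right]; exists e'.
apply/card_eq_fsetP; rewrite /F cardfsU.
rewrite (_ : (_ `&` _)%fset = fset0) ?cardfs0 ?subn0.
  by rewrite !card_imfset//; exact: cons_digit_inj.
apply/fsetP => e; rewrite !inE; apply/negP => /andP[/imfsetP[e1 _ ->]].
by move=> /imfsetP[e2 _] /(congr1 (@^~ 0%N)).
Qed.

Section expansions.
Variables (R : realType) (q : R).
Hypothesis q12 : 1 < q < 2.
Local Notation E := (q_expansions q).

Let q1 : 1 < q. Proof. by case/andP: q12. Qed.
Let q0 : 0 < q. Proof. exact: lt_trans ltr01 q1. Qed.
Let qn0 : q != 0. Proof. by rewrite gt_eqF. Qed.
Let Vq1 : `|q^-1| < 1.
Proof. by rewrite ger0_norm ?invr_ge0 ?ltW// invf_lt1. Qed.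

Lemma cvg_expnN : q ^- n @[n --> \oo] --> 0.
Proof.
rewrite (_ : (fun n => q ^- n) = (fun n => q^-1 ^+ n)); first exact: cvg_expr.
by apply/funext => n; rewrite exprVn.
Qed.

Lemma series_digits_shift (e : nat -> bool) n :
  series (fun i : nat => (e i)%:R * q ^- i.+1) n.+1 =
  q^-1 * ((e 0%N)%:R + series (fun i : nat => (e i.+1)%:R * q ^- i.+1) n).
Proof.
rewrite /series /= !big_mkord big_ord_recl /= expr1 mulrDr [q^-1 * _]mulrC.
congr (_ + _); rewrite mulr_sumr; apply: eq_bigr => i _.
by rewrite /bump /= add1n exprS invfM mulrCA.
Qed.

(** Dropping the first digit [d] is the affine map [x |-> q * x - d]: this
    turns the counting of expansions into the dynamics of [x |-> q * x] and
    [x |-> q * x - 1]. *)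
Lemma expansion_tail x e :
  E x e <-> E (q * x - (e 0%N)%:R) (tail_digits e).
Proof.
rewrite /q_expansions /= -(cvg_shiftS (series _)).
under eq_fun do rewrite series_digits_shift.
split=> h.
- rewrite (_ : series _ = fun n => q * (q^-1 * ((e 0%N)%:R +
    series (fun i : nat => (e i.+1)%:R * q ^- i.+1) n)) - (e 0%N)%:R).
    by apply: cvgB; [exact: cvgMl_tmp|exact: cvg_cst].
  by apply/funext => n; rewrite mulVKf// [in RHS]addrC addKr.
- have -> : x = q^-1 * ((e 0%N)%:R + (q * x - (e 0%N)%:R)).
    by rewrite subrKC mulKf.
  by apply: cvgMl_tmp; apply: cvgD => //; exact: cvg_cst.
Qed.

Lemma expansions_split x :
  E x = cons_digit false @` E (q * x) `|` cons_digit true @` E (q * x - 1).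
Proof.
apply/seteqP; split => e.
  move=> /expansion_tail; case h : (e 0%N) => /= H; [right|left];
  (exists (tail_digits e); [by rewrite ?subr0 in H|by rewrite -h cons_tail]).
by case=> -[e' H <-]; apply/expansion_tail; rewrite //= subr0.
Qed.

Lemma expansion_bounds x e : E x e -> 0 <= x <= (q - 1)^-1.
Proof.
move=> h; have cv : cvgn (series (fun i : nat => (e i)%:R * q ^- i.+1)).
  by apply/cvg_ex; exists x.
have <- : limn (series (fun i : nat => (e i)%:R * q ^- i.+1)) = x.
  exact/cvg_lim.
have qi i : 0 <= q ^- i by rewrite invr_ge0 exprn_ge0// ltW.
apply/andP; split.
  apply: limr_ge => //; apply: nearW => n.
  by rewrite /series /=; apply: sumr_ge0 => i _; rewrite mulr_ge0.
have g : series (geometric q^-1 q^-1) @ \oo --> (q - 1)^-1.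
  rewrite (_ : (q - 1)^-1 = q^-1 / (1 - q^-1)); first exact: cvg_geometric_series.
  by field; rewrite qn0 subr_eq0 gt_eqF.
rewrite -(cvg_lim _ g)//; apply: ler_lim => //; first exact: (cvgP _ g).
apply: nearW => n; rewrite /series /=; apply: ler_sum => i _.
rewrite /geometric /= -exprS exprVn; case: (e i); first by rewrite mul1r.
by rewrite mul0r.
Qed.

Lemma expansions_out (x : R) : ~~ (0 <= x <= (q - 1)^-1) -> E x = set0.
Proof.
by move=> /negP h; apply/seteqP; split => // e /expansion_bounds.
Qed.

Let q_gt1B : 0 < q - 1. Proof. by rewrite subr_gt0. Qed.

Fixpoint greedy_orbit (x : R) (n : nat) : R :=
  if n is m.+1 then let y := greedy_orbit x m in q * y - (1 <= q * y)%R%:R else x.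

(** The greedy digits work: the orbit stays in [[0, 1 / (q - 1)]] because
    [q < 2], so the remainder [q ^- n * greedy_orbit x n] tends to 0. *)
Lemma expansions_in (x : R) : 0 <= x <= (q - 1)^-1 -> exists e, E x e.
Proof.
move=> hx; pose r := greedy_orbit x; exists (fun n => 1 <= q * r n).
have rb n : 0 <= r n <= (q - 1)^-1.
  have hV : q * (q - 1)^-1 - 1 = (q - 1)^-1 by field; rewrite gt_eqF.
  elim: n => // n /andP[h1 h2]; rewrite /r /= -/(r n).
  have h3 : q * r n - 1 <= (q - 1)^-1 by rewrite -hV lerD2r ler_pM2l.
  have [h|h] := leP 1 (q * r n) => /=; first by rewrite subr_ge0 h.
  rewrite subr0 mulr_ge0 ?(ltW q0)//=.
  by apply: (le_trans (ltW h)); rewrite invf_ge1//; have := q12; lra.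
have rS n : series (fun i : nat => (1 <= q * r i)%R%:R * q ^- i.+1) n =
    x - q ^- n * r n.
  elim: n => [|n ih]; first by rewrite /series /= big_geq// expr0 invr1 mul1r subrr.
  rewrite seriesSr ih (_ : r n.+1 = q * r n - (1 <= q * r n)%R%:R) // exprS.
  by field; rewrite expf_neq0.
rewrite /q_expansions /=.
rewrite (_ : series _ = fun n => x - q ^- n * r n); last exact/funext.
rewrite -[X in _ --> X]subr0; apply: cvgB; first exact: cvg_cst.
have c0 : q ^- n * (q - 1)^-1 @[n --> \oo] --> 0.
  rewrite -[X in _ --> X](mul0r (q - 1)^-1).
  by apply: cvgMr_tmp; exact: cvg_expnN.
apply: (squeeze_cvgr _ _ c0); last exact: (@cvg_cst R).
apply: nearW => n; have /andP[h1 h2] := rb n.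
have qi : 0 <= q ^- n by rewrite invr_ge0 exprn_ge0// ltW.
by rewrite mulr_ge0//= ler_wpM2l.
Qed.

Lemma card_expansions_out (x : R) : ~~ (0 <= x <= (q - 1)^-1) -> E x #= `I_0.
Proof. by move=> /expansions_out ->; rewrite II0 card_eq00. Qed.

Lemma card_expansions_in (x : R) k : 0 <= x <= (q - 1)^-1 -> E x #= `I_k -> (0 < k)%N.
Proof.
move=> /expansions_in[e Ee]; case: k => //; rewrite II0 card_eq0 => /eqP h.
by rewrite h in Ee.
Qed.

(** The counting rule behind the whole proof: the expansions of [x] are those
    of its two children [q * x] and [q * x - 1], a child outside
    [[0, 1 / (q - 1)]] contributing none. *)
Lemma card_expansionsD {x a b} : E (q * x) #= `I_a -> E (q * x - 1) #= `I_b ->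
  E x #= `I_(a + b).
Proof. by rewrite (expansions_split x); exact: card_cons_digits. Qed.

Lemma card_expansions_inv {x k} : E x #= `I_k ->
  exists a b, [/\ E (q * x) #= `I_a, E (q * x - 1) #= `I_b & k = (a + b)%N].
Proof.
move=> Ek; have : finite_set (E x) by exists k.
rewrite expansions_split finite_setU => -[f0 f1].
have inj d (A : set (nat -> bool)) : finite_set (cons_digit d @` A) -> finite_set A.
  by rewrite (eq_finite_set (inj_card_eq _))// => ? ? _ _; exact: cons_digit_inj.
have [[a Ea] [b Eb]] := (inj _ _ f0, inj _ _ f1).
exists a, b; split=> //.
have := card_expansionsD Ea Eb; rewrite (card_eql Ek) => h; exact/card_eq_II.
Qed.

Lemma card_expansions_uniq {x a b} : E x #= `I_a -> E x #= `I_b -> a = b.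
Proof. by move=> Ea Eb; apply/card_eq_II; rewrite -(card_eql Ea). Qed.

(** Exchanging the digits 0 and 1 is the reflection of the interval. *)
Lemma expansion_compl x e :
  E x e -> E ((q - 1)^-1 - x) (fun n => ~~ e n).
Proof.
rewrite /q_expansions /= => h.
have g : series (geometric q^-1 q^-1) @ \oo --> (q - 1)^-1.
  rewrite (_ : (q - 1)^-1 = q^-1 / (1 - q^-1)); first exact: cvg_geometric_series.
  by field; rewrite qn0 subr_eq0 gt_eqF.
rewrite (_ : series _ = series (geometric q^-1 q^-1) \-
    series (fun i : nat => (e i)%:R * q ^- i.+1)); first exact: cvgB.
apply/funext => n; rewrite /series /= -[RHS]sumrB; apply: eq_bigr => i _.
rewrite /geometric /= -exprS exprVn; case: (e i) => /=.
  by rewrite mul1r mul0r subrr.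
by rewrite mul1r mul0r subr0.
Qed.

Lemma card_expansions_compl {x k} : E x #= `I_k -> E ((q - 1)^-1 - x) #= `I_k.
Proof.
move=> Ek; rewrite -(card_eqr Ek).
pose c := fun (e : nat -> bool) n => ~~ e n.
have cK : involutive c by move=> e; apply/funext => n; exact: negbK.
rewrite (_ : E ((q - 1)^-1 - x) = c @` E x).
  by apply: inj_card_eq; apply: in2W; exact: inv_inj.
apply/seteqP; split => e.
  move=> /expansion_compl; rewrite subKr => h; exists (c e) => //; exact: cK.
by move=> [e' h <-]; exact: expansion_compl.
Qed.

End expansions.

(** * Branch points *)

Section branching.
Variables (R : realType) (q : R).
Hypothesis q12 : 1 < q < 2.
Local Notation E := (q_expansions q).
Local Notation V := ((q - 1)^-1).

Let q1 : 1 < q. Proof. by case/andP: q12. Qed.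
Let q0 : 0 < q. Proof. exact: lt_trans ltr01 q1. Qed.

(** Following an orbit as long as the next digit is forced keeps the number of
    expansions; it must branch before the index where [e] and [e'] differ. *)
Lemma branch_point {n k x e e'} :
  E x #= `I_k -> E x e -> E x e' -> e n != e' n ->
  exists z a b, [/\ (0 < a)%N, (0 < b)%N, k = (a + b)%N,
    E (q * z) #= `I_a & E (q * z - 1) #= `I_b].
Proof.
elim: n x e e' => [|n ih] x e e' Ek xe xe' ne;
  have [a [b [Ea Eb kab]]] := card_expansions_inv q12 Ek;
  (case: a => [|a] in Ea kab *; last (case: b => [|b] in Eb kab *; last
    by exists x, a.+1, b.+1)).
- move: Ea; rewrite II0 card_eq0 => /eqP Ea.
  suff h f : E x f -> f 0%N = true by rewrite (h _ xe) (h _ xe') in ne.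
  by move=> /(expansion_tail q12); case: (f 0%N); rewrite //= subr0 Ea.
- move: Eb; rewrite II0 card_eq0 => /eqP Eb.
  suff h f : E x f -> f 0%N = false by rewrite (h _ xe) (h _ xe') in ne.
  by move=> /(expansion_tail q12); case: (f 0%N); rewrite //= Eb.
- move: Ea; rewrite II0 card_eq0 => /eqP Ea.
  have h f : E x f -> E (q * x - 1) (tail_digits f).
    by move=> /(expansion_tail q12); case: (f 0%N); rewrite //= subr0 Ea.
  by rewrite add0n in kab; subst b; exact: ih Eb (h _ xe) (h _ xe') ne.
- move: Eb; rewrite II0 card_eq0 => /eqP Eb.
  have h f : E x f -> E (q * x) (tail_digits f).
    by move=> /(expansion_tail q12); case: (f 0%N); rewrite /= ?subr0 ?Eb.
  by rewrite addn0 in kab; subst k; exact: ih Ea (h _ xe) (h _ xe') ne.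
Qed.

Lemma two_expansions {k x} : (1 < k)%N -> E x #= `I_k ->
  exists e e' n, [/\ E x e, E x e' & e n != e' n].
Proof.
move=> k1 Ek; have fE : finite_set (E x) by exists k.
rewrite -(fset_setK fE) in Ek *; move: (fset_set _) Ek => F /card_eq_fsetP Fk.
move: k1; rewrite -Fk; case: (fset_0Vmem F) => [->|[e eF]]; first by rewrite cardfs0.
rewrite (cardfsD1 e) eF ltnS; case: (fset_0Vmem (F `\ e)%fset) => [->|[e' e'F] _].
  by rewrite cardfs0.
move: e'F; rewrite !inE => /andP[ne e'F].
have [n nen] : exists n, e n != e' n.
  apply: contrapT => h; case/eqP: ne; apply/funext => n; apply: contrapT => h'.
  by apply: h; exists n; apply/eqP => h''; exact/h'/esym.
by exists e, e', n.
Qed.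

(** Descend in the tree of expansions into a child with at least three
    expansions as long as there is one. The bound [minn k 3] keeps two facts
    together: from [k = 2] one reaches children with one expansion each, and
    from [k >= 3] children that do not both have a single one. *)
Lemma branch_point_small k x : (1 < k)%N -> E x #= `I_k ->
  exists z a b, [/\ (0 < a <= 2)%N, (0 < b <= 2)%N, (minn k 3 <= a + b <= k)%N,
    E (q * z) #= `I_a & E (q * z - 1) #= `I_b].
Proof.
elim/ltn_ind: k x => k ih x k1 Ek.
have [e [e' [n [xe xe' ne]]]] := two_expansions k1 Ek.
have [z [a [b [a0 b0 kab Ea Eb]]]] := branch_point Ek xe xe' ne.
have [a3|a2] := ltnP 2 a.
  have [ak a1] : (a < k)%N /\ (1 < a)%N by move: b0 a3 kab; clear; lia.
  have [z' [a' [b' [h1 h2 h3 h4 h5]]]] := ih a ak _ a1 Ea.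
  by exists z', a', b'; split; [..|exact: h4|exact: h5] => //; move: a3 ak h3; clear; lia.
have [b3|b2] := ltnP 2 b.
  have [bk b1] : (b < k)%N /\ (1 < b)%N by move: a0 b3 kab; clear; lia.
  have [z' [a' [b' [h1 h2 h3 h4 h5]]]] := ih b bk _ b1 Eb.
  by exists z', a', b'; split; [..|exact: h4|exact: h5] => //; move: b3 bk h3; clear; lia.
by exists z, a, b; split; [..|exact: Ea|exact: Eb];
  move: a0 b0 a2 b2 kab; clear; lia.
Qed.

(** Positivity makes the point lie in the interval, so that this is a
    forward-invariant condition along forced digits. *)
Definition few_expansions n x := exists2 k, (0 < k <= n)%N & E x #= `I_k.

Lemma few_in n x : few_expansions n x -> 0 <= x <= V.
Proof.
move=> [k k0 Ek]; apply/negPn/negP => /(card_expansions_out q12) E0.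
by move: k0; rewrite (card_expansions_uniq Ek E0).
Qed.

Lemma few_compl n x : few_expansions n x -> few_expansions n (V - x).
Proof. by move=> [k kn Ek]; exists k; [exact: kn|exact: (card_expansions_compl q12 Ek)]. Qed.

Lemma few_mul n x : few_expansions n x -> q * x < 1 -> few_expansions n (q * x).
Proof.
move=> [k kn /(card_expansions_inv q12)[a [b [Ea Eb kab]]]] h; exists k; first exact: kn.
have /(card_expansions_out q12) Eb0 : ~~ (0 <= q * x - 1 <= V).
  by rewrite negb_and -ltNge subr_lt0 h.
by rewrite kab (card_expansions_uniq Eb Eb0) addn0.
Qed.

Lemma few_mulB n x : few_expansions n x -> V < q * x -> few_expansions n (q * x - 1).
Proof.
move=> [k kn /(card_expansions_inv q12)[a [b [Ea Eb kab]]]] h; exists k; first exact: kn.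
have /(card_expansions_out q12) Ea0 : ~~ (0 <= q * x <= V).
  by rewrite negb_and -!ltNge h orbT.
by rewrite kab (card_expansions_uniq Ea Ea0).
Qed.

Lemma few2_branch x : few_expansions 2 x -> 1 <= q * x <= V ->
  few_expansions 1 (q * x) /\ few_expansions 1 (q * x - 1).
Proof.
move=> [k kn /(card_expansions_inv q12)[a [b [Ea Eb kab]]]] /andP[h1 h2].
have V1 : V - 1 <= V by rewrite gerBl.
have a0 : (0 < a)%N.
  by apply: (card_expansions_in q12 _ Ea); rewrite h2 (le_trans ler01).
have b0 : (0 < b)%N.
  apply: (card_expansions_in q12 _ Eb); rewrite subr_ge0 h1/=.
  by rewrite (le_trans _ V1)// lerD2r.
have [an bn] : (a <= 1)%N /\ (b <= 1)%N by move: kn kab a0 b0; clear; lia.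
by split; [exists a; rewrite ?a0|exists b; rewrite ?b0].
Qed.

Lemma few1_branch x : few_expansions 1 x -> 1 <= q * x <= V -> False.
Proof.
move=> [k kn /(card_expansions_inv q12)[a [b [Ea Eb kab]]]] h.
have fx : few_expansions 2 x.
  exists k; last by rewrite kab; exact: card_expansionsD.
  by case/andP: kn => -> /leq_trans->.
have [[k1 + Ek1] [k2 + Ek2]] := few2_branch fx h.
rewrite (card_expansions_uniq Ek1 Ea) (card_expansions_uniq Ek2 Eb).
by move: kn kab; clear; lia.
Qed.

End branching.

(** * Orbits that do not branch, for bases up to the threshold *)

Section trap.
Variables (R : realType) (q : R).
Hypothesis q12 : 1 < q < 2.
Hypothesis q_le_threshold : q ^+ 3 <= 2 * q ^+ 2 - q + 1.
Local Notation V := ((q - 1)^-1).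
Local Notation c := ((q ^+ 2 - 1)^-1).

Let q1 : 1 < q. Proof. by case/andP: q12. Qed.
Let q2 : q < 2. Proof. by case/andP: q12. Qed.
Let q0 : 0 < q. Proof. exact: lt_trans ltr01 q1. Qed.
Let V_def : q * V = V + 1. Proof. by field; rewrite subr_eq0 gt_eqF. Qed.
Let V1 : 1 < V. Proof. by rewrite invf_gt1 ?subr_gt0// ltrBlDr. Qed.
Let c_def : q ^+ 2 * c = c + 1.
Proof. by field; rewrite subr_eq0 gt_eqF// exprn_egt1. Qed.
Let c0 : 0 < c. Proof. by rewrite invr_gt0 subr_gt0 exprn_egt1. Qed.

Lemma expn_unbounded (y : R) : exists N, y < q ^+ N.
Proof.
have [y0|y0] := leP y 0; first by exists 0%N; rewrite expr0 (le_lt_trans y0).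
have Vy : 0 < y^-1 by rewrite invr_gt0.
have [N _ /(_ N)] := cvgr_lt _ (cvg_expnN q12) _ Vy; rewrite /= leqnn => /(_ isT) h.
by exists N; rewrite -ltf_pV2// posrE exprn_gt0.
Qed.

(** Above the golden ratio, the points up to [V - 1] lie below the branching
    zone [[1 / q, V / q]], so that their first digit is a forced 0. *)
Lemma golden_lt : q + 1 < q ^+ 2 <-> q * (V - 1) < 1.
Proof.
have -> : (q * (V - 1) < 1) = (1 + (1 - q) * (q - 1) < 1 * (q - 1)).
  have -> : 1 + (1 - q) * (q - 1) = q * (V - 1) * (q - 1).
    by field; rewrite subr_eq0 gt_eqF.
  by rewrite ltr_pM2r ?subr_gt0.
by split=> h; lra.
Qed.

(** This is where the threshold [q_f] enters: it is an equality at [q_f], and it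
    forces the image of a point above [V - 1] to be at least [1 / q], so that
    the digit after a forced 0 is either free or 1. *)
Lemma hole_image : 1 <= q * (q * (V - 1)).
Proof.
have -> : q * (V - 1) = V + 1 - q by rewrite mulrBr V_def mulr1.
rewrite -(ler_pM2r (_ : 0 < q - 1)) ?subr_gt0//.
have -> : q * (V + 1 - q) * (q - 1) = q * (1 + (1 - q) * (q - 1)).
  by rewrite -mulrA -addrA mulrDl mulVf// subr_eq0 gt_eqF.
by have := q_le_threshold; lra.
Qed.

(** As long as it does not branch, an orbit that starts between [V - 1] and 1
    must alternate the digits 0 and 1. Two steps are the map
    [x |-> q ^ 2 * x - 1], which expands distances to its fixed point [c] by
    [q ^ 2]; hence the orbit is that of [c] or it branches, at an even time
    (second case) or at an odd time (third case). *)
Lemma orbit_trap (A : R -> Prop) (d p : R) :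
  q + 1 < q ^+ 2 -> q - 1 <= d -> q * d <= V ->
  (forall x, A x -> q * x < 1 -> A (q * x)) ->
  (forall x, A x -> V < q * x -> A (q * x - 1)) ->
  A p -> V - 1 < p <= d ->
  [\/ p = c,
      exists n b, [/\ b = c + q ^+ (2 * n) * (p - c), A b, 1 <= q * b <= V & b <= d] |
      exists n r, [/\ r = c + q ^+ (2 * n) * (p - c), A (q * r),
                     1 <= q * (q * r) <= V & V - 1 < r]].
Proof.
move=> qG d1 d2 A0 A1 Ap pd.
have [->|pc] := eqVneq p c; first by apply: Or31.
have pc0 : 0 < `|p - c| by rewrite normr_gt0 subr_eq0.
have [N] := expn_unbounded (`|p - c|^-1).
rewrite -(ltr_pM2r pc0) mulVf ?gt_eqF// => hN.
have {}hN : 1 < q ^+ (2 * N) * `|p - c|.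
  apply: (lt_le_trans hN); rewrite ler_pM2r//.
  by apply: ler_weXn2l; [exact: ltW|exact: leq_pmull].
have cV : q * c < 1.
  rewrite -(ltr_pM2r (_ : 0 < q ^+ 2 - 1)) ?subr_gt0 ?exprn_egt1//.
  by rewrite mulfVK; [lra|rewrite subr_eq0 gt_eqF// exprn_egt1].
have c1 : c < 1.
  by rewrite invf_lt1 ltrBrDr (lt_trans _ qG)// ?ltrD2r// add0r ltrDr.
suff : (exists n b, [/\ b = c + q ^+ (2 * n) * (p - c), A b, 1 <= q * b <= V & b <= d]) \/
  exists n r, [/\ r = c + q ^+ (2 * n) * (p - c), A (q * r),
                     1 <= q * (q * r) <= V & V - 1 < r].
  by case=> h; [apply: Or32|apply: Or33].
have dlt1 : d < 1.
  have : V < q.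
    rewrite -(ltr_pM2r (_ : 0 < q - 1)) ?subr_gt0// mulVf ?subr_eq0 ?gt_eqF//.
    lra.
  by move=> ?; rewrite -(ltr_pM2l q0); lra.
elim: N p pc pc0 Ap pd hN => [|N ih] p pc pc0 Ap /andP[p1 p2] hN.
  move: hN; rewrite expr0 mul1r ltNge => /negP[].
  by rewrite ler_norml; have := V1; have := c0; move=> *; apply/andP; split; lra.
have [qp|qp] := leP 1 (q * p).
  left; exists 0%N, p; rewrite expr0 mul1r subrKC; split=> //.
  by rewrite qp/=; apply: le_trans d2; rewrite ler_pM2l.
have Aqp := A0 _ Ap qp.
have h1 : 1 <= q * (q * p).
  by apply: (le_trans hole_image); rewrite !ler_pM2l// ltW.
have [h2|h2] := leP (q * (q * p)) V.
  right; exists 0%N, p; rewrite expr0 mul1r subrKC; split=> //.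
  by rewrite h1.
have p'E : q * (q * p) - 1 - c = q ^+ 2 * (p - c).
  by rewrite mulrBr c_def; ring.
have p'0 : q * (q * p) - 1 - c != 0 by rewrite p'E mulf_neq0// ?subr_eq0// gt_eqF// exprn_gt0.
have nE n : q ^+ (2 * n) * (q * (q * p) - 1 - c) = q ^+ (2 * n.+1) * (p - c).
  by rewrite p'E mulrA -exprD mulnS addnC.
have [||||||] := ih (q * (q * p) - 1).
- by rewrite -subr_eq0.
- by rewrite normr_gt0.
- exact: A1.
- by rewrite ltrD2r h2/=; apply: le_trans d1; rewrite lerD2r -[leRHS]mulr1 ler_pM2l// ltW.
- by rewrite -[q ^+ _]ger0_norm ?exprn_ge0 ?(ltW q0)// -normrM nE normrM ger0_norm// exprn_ge0// ltW.
- by move=> [n [b [bE h3 h4 h5]]]; left; exists n.+1, b; split; rewrite // bE nE.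
- by move=> [n [b [bE h3 h4 h5]]]; right; exists n.+1, b; split; rewrite // bE nE.
Qed.

(** A small point has forced digits 0 until it enters the next scale. *)
Lemma scale_into (A : R -> Prop) (l v : R) :
  (forall x, A x -> x <= l -> A (q * x)) -> A v -> 0 < v <= l ->
  exists m, A (q ^+ m.+1 * v) /\ l < q ^+ m.+1 * v <= q * l.
Proof.
move=> A0 Av /andP[v0 vl].
have [N hN] := expn_unbounded (l / v).
rewrite ltr_pdivrMr// in hN.
elim: N v Av v0 vl hN => [|N ih] v Av v0 vl hN.
  by move: hN; rewrite expr0 mul1r ltNge vl.
have qvl : q * v <= q * l by rewrite ler_pM2l.
have Aqv : A (q * v) by apply: A0.
have [h|h] := leP (q * v) l; last by exists 0%N; rewrite expr1 h.
have [||m [h1 h2]] := ih (q * v) Aqv _ h.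
- exact: mulr_gt0.
- by rewrite mulrA -exprSr.
by exists m.+1; rewrite [q ^+ m.+2]exprSr -mulrA.
Qed.

(** A univoque point never branches, so after its initial zeros it is [c] by
    [orbit_trap]. Up to the golden ratio the interval [[1 / q, 1]], which the
    orbit of every positive point below [1 / q] visits, consists of branching
    points only. *)
Lemma few1_small v : few_expansions q 1 v -> 0 < v <= V - 1 ->
  q + 1 < q ^+ 2 /\ exists m, v = q ^- m.+1 * c.
Proof.
move=> fv /andP[v0 vl].
have fm x : few_expansions q 1 x -> q * x < 1 -> few_expansions q 1 (q * x) by exact: few_mul.
have fB x : few_expansions q 1 x -> V < q * x -> few_expansions q 1 (q * x - 1) by exact: few_mulB.
have nS x : few_expansions q 1 x -> 1 <= q * x <= V -> False by exact: few1_branch.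
have [qG|qG] := ltP (q + 1) (q ^+ 2); last first.
  exfalso.
  have Vq : q <= V.
    rewrite -(ler_pM2r (_ : 0 < q - 1)) ?subr_gt0// mulVf ?subr_eq0 ?gt_eqF//.
    lra.
  have qv1 : q * v < 1.
    have [h|//] := leP 1 (q * v).
    have [h2|h2] := leP (q * v) V; first by case: (nS _ fv); rewrite h.
    (* the reflected point is then both at least 1 and below 1 / q *)
    have h3 : q * (V - v) < 1 by rewrite mulrBr V_def; lra.
    have : q * 1 <= q * (V - v) by rewrite ler_pM2l//; lra.
    by have := q1; lra.
  have fl x : few_expansions q 1 x -> x <= q^-1 -> few_expansions q 1 (q * x).
    move=> fx; rewrite -(ler_pM2l q0) (mulfV (lt0r_neq0 q0)) => h; apply: (fm _ fx).
    rewrite lt_neqAle h andbT; apply/eqP => h1.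
    by apply: (nS x fx); rewrite h1 lexx ltW.
  have vq : 0 < v <= q^-1.
    by rewrite v0 -(ler_pM2l q0) mulfV ?gt_eqF// ltW.
  have [m [fx]] := scale_into fl fv vq.
  rewrite mulfV ?gt_eqF// => /andP[h1 h2]; apply: (nS _ fx).
  rewrite -(ltr_pM2l q0) mulfV ?gt_eqF// in h1; rewrite (ltW h1)/=.
  by apply: le_trans Vq; rewrite -[leRHS]mulr1 ler_pM2l.
split=> //.
have qL := golden_lt.1 qG.
have fl x : few_expansions q 1 x -> x <= V - 1 -> few_expansions q 1 (q * x).
  by move=> fx h; apply: fm => //; apply: le_lt_trans qL; rewrite ler_pM2l.
have vb : 0 < v <= V - 1 by rewrite v0.
have [m [fp pl]] := scale_into fl fv vb.
exists m.
have d1 : q - 1 <= V / q.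
  rewrite ler_pdivlMr// -(ler_pM2r (_ : 0 < q - 1)) ?subr_gt0// mulVf ?subr_eq0 ?gt_eqF//.
  by have := q_le_threshold; lra.
have d2 : q * (V / q) <= V by rewrite mulrC divfK// gt_eqF.
have pd : V - 1 < q ^+ m.+1 * v <= V / q.
  case/andP: pl => -> h /=; apply: (le_trans h).
  rewrite ler_pdivlMr// mulrBr V_def mulr1.
  rewrite -(ler_pM2r (_ : 0 < q - 1)) ?subr_gt0// mulVf ?subr_eq0 ?gt_eqF//.
  have -> : (V + 1 - q) * q * (q - 1) = q * (1 + (1 - q) * (q - 1)).
    by field; rewrite subr_eq0 gt_eqF.
  by move: qG q1; nra.
have [|[n [b [_ fb Sb _]]]|[n [r [_ fb Sb _]]]] := orbit_trap qG d1 d2 fm fB fp pd.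
- by move=> <-; rewrite mulKf// expf_neq0// gt_eqF.
- by case: (nS _ fb).
- by case: (nS _ fb).
Qed.

End trap.

(** * Branch points with two univoque children *)

Section two_expansions.
Variables (R : realType) (q : R).
Hypothesis q12 : 1 < q < 2.
Local Notation E := (q_expansions q).
Local Notation V := ((q - 1)^-1).
Local Notation c := ((q ^+ 2 - 1)^-1).
Local Notation s := (q^-1).

Let q1 : 1 < q. Proof. by case/andP: q12. Qed.
Let q2 : q < 2. Proof. by case/andP: q12. Qed.
Let q0 : 0 < q. Proof. exact: lt_trans ltr01 q1. Qed.
Let qn0 : q != 0. Proof. by rewrite gt_eqF. Qed.
Let qB0 : q - 1 != 0. Proof. by rewrite subr_eq0 gt_eqF. Qed.
Let qqB0 : q ^+ 2 - 1 != 0. Proof. by rewrite subr_eq0 gt_eqF// exprn_egt1. Qed.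
Let c0 : 0 < c. Proof. by rewrite invr_gt0 subr_gt0 exprn_egt1. Qed.
Let s0 : 0 < s. Proof. by rewrite invr_gt0. Qed.
Let s1 : s < 1. Proof. by rewrite invf_lt1. Qed.

Lemma hole_cycle : V - 1 = c * ((2 - q) * (q + 1)).
Proof. by field; rewrite qB0 qqB0. Qed.

(** The equation satisfied by a branch point with two univoque children. The
    differences in the inequalities [f1], [f2], [f3] of the proof are positive
    multiples of [q ^ 2 - q - 1], of the polynomial of [q_f] and
    of [2 + 2 * q - q ^ 3]; they leave only the exponents 1 and 3. *)
Lemma two_powers (a b : R) :
  q + 1 < q ^+ 2 -> q ^+ 3 < 2 * q ^+ 2 - q + 1 ->
  a = 0 \/ (exists m, a = s ^+ m.+1) -> b = 0 \/ (exists m, b = s ^+ m.+1) ->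
  a + b = (2 - q) * (q + 1) ->
  q ^+ 4 = 2 * q ^+ 2 + q + 1 /\ (b = s \/ b = s ^+ 3).
Proof.
move=> qG qf ha hb; set f := (2 - q) * _ => fE.
have s2 : 0 < s ^+ 2 by rewrite exprn_gt0.
have s4 : 0 < s ^+ 4 by rewrite exprn_gt0.
have dec k : s ^+ k.+1 < s ^+ k by rewrite exprSr gtr_pMr// exprn_gt0.
have d1 := dec 1%N; have d2 := dec 2%N; have d3 := dec 3%N; rewrite expr1 in d1.
have small x : x = 0 \/ (exists m, x = s ^+ m.+1) ->
    [\/ x = s, x = s ^+ 2, x = s ^+ 3 | 0 <= x <= s ^+ 4].
  case=> [->|[[|[|[|m]]] ->]]; [by apply: Or44; rewrite lexx ltW|exact: Or41| exact: Or42|exact: Or43|].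
  apply: Or44; rewrite exprn_ge0 ?(ltW s0)//=.
  by apply: ler_wiXn2l; rewrite ?ltW.
have f1 : f < s + s ^+ 2.
  have : 0 < s ^+ 2 * ((q ^+ 2 - q - 1) * (q ^+ 2 - 1)).
    by rewrite mulr_gt0// mulr_gt0 ?subr_gt0 ?exprn_egt1//; lra.
  rewrite (_ : s ^+ 2 * _ = s + s ^+ 2 - f); first by rewrite subr_gt0.
  by rewrite /f; field.
have f2 : s + s ^+ 4 < f.
  have : 0 < s ^+ 4 * ((2 * q ^+ 2 - q + 1 - q ^+ 3) * ((q ^+ 2 - 1) * (q + 1))).
    by rewrite mulr_gt0// mulr_gt0 ?subr_gt0// mulr_gt0 ?subr_gt0 ?exprn_egt1// addr_gt0.
  rewrite (_ : s ^+ 4 * _ = f - (s + s ^+ 4)); first by rewrite subr_gt0.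
  by rewrite /f; field.
have f3 : 2 * s ^+ 2 < f.
  have q3 : 0 < 2 + 2 * q - q ^+ 3.
    have [h'|h'] := leP q (9 / 5); last first.
      have : 0 < (q - 9/5) * (q ^+ 2) by rewrite mulr_gt0 ?exprn_gt0 ?subr_gt0.
      have : 0 < (q - 9/5) * q by rewrite mulr_gt0 ?subr_gt0.
      by move: q2 => h1 h2 h3; nra.
    have : 0 < (q - 1) * (2 - q) by rewrite mulr_gt0 ?subr_gt0.
    by move: qf q1; nra.
  have : 0 < s ^+ 2 * ((q - 1) * (2 + 2 * q - q ^+ 3)).
    by rewrite mulr_gt0// mulr_gt0// subr_gt0.
  rewrite (_ : s ^+ 2 * _ = f - 2 * s ^+ 2); first by rewrite subr_gt0.
  by rewrite /f; field.
have f4 : f = s + s ^+ 3 -> q ^+ 4 = 2 * q ^+ 2 + q + 1.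
  move=> h.
  have : (q - 1) * (q ^+ 4 - (2 * q ^+ 2 + q + 1)) = q ^+ 3 * (s + s ^+ 3 - f).
    by rewrite /f; field.
  rewrite h subrr mulr0 => /eqP.
  by rewrite mulf_eq0 (negPf qB0) subr_eq0 => /eqP.
case: (small _ ha) => [ha'|ha'|ha'|/andP[ha1 ha2]];
  case: (small _ hb) => [hb'|hb'|hb'|/andP[hb1 hb2]];
  try (exfalso; move: f1 f2 f3 d1 d2 d3 s2 s4 fE; lra).
- by split; [apply: f4; rewrite -fE ha' hb'|right].
- by split; [apply: f4; rewrite -fE ha' hb' addrC|left].
Qed.

(** For a branch point [z], the points [q * z - 1] and [V - q * z] add up to
    [V - 1], and by reflection the latter has as many expansions as [q * z].
    Below [q_f] the only base with a point having exactly two expansions is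
    therefore the root of [x ^ 4 = 2 * x ^ 2 + x + 1]. *)
Lemma few1_pair u v : q ^+ 3 < 2 * q ^+ 2 - q + 1 ->
  few_expansions q 1 u -> few_expansions q 1 v -> u + v = V - 1 ->
  [/\ q + 1 < q ^+ 2, q ^+ 4 = 2 * q ^+ 2 + q + 1 & v = c * s \/ v = c * s ^+ 3].
Proof.
move=> qf fu fv uv.
have /andP[u0 _] := few_in q12 fu; have /andP[v0 _] := few_in q12 fv.
have L0 : 0 < V - 1 by rewrite hole_cycle mulr_gt0// mulr_gt0 ?subr_gt0 ?addr_gt0.
have ex w : few_expansions q 1 w -> 0 <= w -> w <= V - 1 ->
    w = 0 \/ q + 1 < q ^+ 2 /\ exists m, w = c * s ^+ m.+1.
  move=> fw; rewrite le_eqVlt => /orP[/eqP <-|w0 wl]; first by left.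
  right; have [|qG [m ->]] := few1_small q12 (ltW qf) fw; first by rewrite w0.
  by split=> //; exists m; rewrite exprVn mulrC.
have hu := ex u fu u0 ltac:(lra); have hv := ex v fv v0 ltac:(lra).
have qG : q + 1 < q ^+ 2 by case: hu => [|[]//]; case: hv => [|[]//]; lra.
have scale w : w = 0 \/ q + 1 < q ^+ 2 /\ (exists m, w = c * s ^+ m.+1) ->
    w / c = 0 \/ exists m, w / c = s ^+ m.+1.
  case=> [->|[_ [m ->]]]; [by left; rewrite mul0r|right; exists m].
  by rewrite [c * _]mulrC mulfK// invr_neq0.
have [|q4 h] := two_powers qG qf (scale _ hu) (scale _ hv).
  by rewrite -mulrDl uv hole_cycle mulrC mulKf// invr_neq0.
split=> //; case: h => <-; [left|right]; by rewrite mulrC divfK// invr_neq0.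
Qed.

(** Both digits of the period [01] are forced above the golden ratio. *)
Lemma card_cycle : q + 1 < q ^+ 2 -> E c #= `I_1.
Proof.
move=> qG.
have cq : q * c < 1.
  by rewrite ltr_pdivrMr ?subr_gt0 ?exprn_egt1// mul1r ltrBrDr.
have cV : V - 1 < c.
  by rewrite hole_cycle gtr_pMr//; move: qG; lra.
have E1 : E (q * c - 1) = set0.
  by apply: (expansions_out q12); rewrite negb_and -ltNge subr_lt0 cq.
have qqc : q * (q * c) = c + 1 by field; rewrite qqB0.
have E2 : E (q * (q * c)) = set0.
  by apply: (expansions_out q12); rewrite negb_and -!ltNge qqc -ltrBlDr cV orbT.
have tl e : E c e -> [/\ e 0%N = false, e 1%N = true & E c (tail_digits (tail_digits e))].
  move=> /(expansion_tail q12); case: (e 0%N) => /=; first by rewrite E1.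
  move=> /(expansion_tail q12); rewrite subr0 -[tail_digits e 0%N]/(e 1%N).
  case: (e 1%N) => /=; first by rewrite qqc addrK.
  by rewrite subr0 E2.
have h n : forall e, E c e -> e n = odd n /\ e n.+1 = odd n.+1.
  elim: n => [|n ih] e xe; have [e0 e1 xt] := tl _ xe; first by rewrite e0 e1.
  by have [e2 _] := ih _ xt; have [_ e3] := ih _ xe; split=> //; rewrite /= negbK -e2.
have [|e0 xe0] := @expansions_in _ q q12 c.
  rewrite ltW//=; apply: (le_trans (_ : _ <= 1)).
    by rewrite invf_le1 ?subr_gt0 ?exprn_egt1//; have := q1; lra.
  by rewrite invf_ge1 ?subr_gt0//; have := q2; lra.
rewrite (_ : E c = [set e0]); first exact: card_set1.
apply/seteqP; split=> [e xe|e ->//] /=; apply/funext => n.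
by have [-> _] := h n _ xe; have [-> _] := h n _ xe0.
Qed.

Lemma card_cycle_shift n : q + 1 < q ^+ 2 -> E (c * s ^+ n) #= `I_1.
Proof.
move=> qG; elim: n => [|n ih]; first by rewrite expr0 mulr1; exact: card_cycle.
have h : q * (c * s ^+ n.+1) = c * s ^+ n by rewrite [s ^+ _]exprS mulrCA mulVKf.
have h0 : E (q * (c * s ^+ n.+1)) #= `I_1 by rewrite h.
rewrite -[1%N]addn0; apply: (card_expansionsD q12 h0).
apply: (card_expansions_out q12); rewrite negb_and -ltNge subr_lt0 h.
apply/orP; left; apply: (le_lt_trans (_ : _ <= c)).
  by rewrite ger_pMr// exprn_ile1// ltW.
by rewrite invf_lt1 ?subr_gt0 ?exprn_egt1//; have := q1; lra.
Qed.

End two_expansions.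

(** * The base of the points with exactly two expansions *)

Section second_base.
Variables (R : realType) (q : R).
Hypothesis q12 : 1 < q < 2.
Hypothesis q4 : q ^+ 4 = 2 * q ^+ 2 + q + 1.
Local Notation E := (q_expansions q).
Local Notation V := ((q - 1)^-1).
Local Notation c := ((q ^+ 2 - 1)^-1).
Local Notation s := (q^-1).

Let q1 : 1 < q. Proof. by case/andP: q12. Qed.
Let q2 : q < 2. Proof. by case/andP: q12. Qed.
Let q0 : 0 < q. Proof. exact: lt_trans ltr01 q1. Qed.
Let qn0 : q != 0. Proof. by rewrite gt_eqF. Qed.
Let qB0 : q - 1 != 0. Proof. by rewrite subr_eq0 gt_eqF. Qed.
Let qqB0 : q ^+ 2 - 1 != 0. Proof. by rewrite subr_eq0 gt_eqF// exprn_egt1. Qed.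
Let c0 : 0 < c. Proof. by rewrite invr_gt0 subr_gt0 exprn_egt1. Qed.
Let s0 : 0 < s. Proof. by rewrite invr_gt0. Qed.
Let s1 : s < 1. Proof. by rewrite invf_lt1. Qed.

(** The root is about 1.71064; the comparisons of [few2_pair] need bounds of
    about this precision. *)
Lemma second_base_bounds : 53 / 31 < q < 77 / 45.
Proof.
have slope (a : R) : 3 / 2 <= a ->
    0 < q ^+ 3 + a * q ^+ 2 + a ^+ 2 * q + a ^+ 3 - 2 * q - 2 * a - 1.
  move=> ha; have hx : 0 <= q - 1 by rewrite subr_ge0 ltW.
  have hy : 0 <= a - 3 / 2 by rewrite subr_ge0.
  move: (q - 1) (a - 3/2) hx hy (subrK 1 q) (subrK (3/2) a) => x y hx hy <- <-.
  have xy := mulr_ge0 hx hy; have xx := mulr_ge0 hx hx; have yy := mulr_ge0 hy hy.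
  have xxx := mulr_ge0 hx xx; have yyy := mulr_ge0 hy yy.
  have xxy := mulr_ge0 xx hy; have xyy := mulr_ge0 hx yy.
  nra.
have fac (a : R) : (q - a) * (q ^+ 3 + a * q ^+ 2 + a ^+ 2 * q + a ^+ 3 - 2 * q - 2 * a - 1)
    = 2 * a ^+ 2 + a + 1 - a ^+ 4 by ring: q4.
apply/andP; split; rewrite ltNge; apply/negP => h.
- have [hs ha] : 3 / 2 <= 53 / 31 :> R /\
      0 < 2 * (53 / 31) ^+ 2 + 53 / 31 + 1 - (53 / 31) ^+ 4 :> R.
    by split; lra.
  move: ha; rewrite -(fac (53 / 31)) pmulr_lgt0 ?slope// subr_gt0; lra.
- have [hs ha] : 3 / 2 <= 77 / 45 :> R /\
      2 * (77 / 45) ^+ 2 + 77 / 45 + 1 - (77 / 45) ^+ 4 < 0 :> R.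
    by split; lra.
  move: ha; rewrite -(fac (77 / 45)) pmulr_llt0 ?slope// subr_lt0; lra.
Qed.

Let qb1 : 53 / 31 < q. Proof. by case/andP: second_base_bounds. Qed.
Let qb2 : q < 77 / 45. Proof. by case/andP: second_base_bounds. Qed.

Lemma second_base_lt : q ^+ 3 < 2 * q ^+ 2 - q + 1.
Proof.
suff : 0 < 1 - q * (q - 1) ^+ 2 by lra.
have h1 : (q - 1) ^+ 2 <= (32 / 45) ^+ 2.
  by rewrite lerXn2r ?nnegrE; have := qb2; have := q1; lra.
have h2 : 0 <= (q - 1) ^+ 2 by rewrite sqr_ge0.
have := qb2; nra.
Qed.

Lemma second_base_golden : q + 1 < q ^+ 2.
Proof. by have := qb1; have := q1; nra. Qed.

Lemma hole_second : V - 1 = c * (s + s ^+ 3).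
Proof.
apply: (mulfI (expf_neq0 3 qn0)).
rewrite (_ : q ^+ 3 * (c * (s + s ^+ 3)) = c * (q ^+ 2 + 1)); last first.
  by field; rewrite qn0 qqB0.
rewrite hole_cycle// mulrCA; congr (_ * _).
have : (q - 1) * (q ^+ 4 - (2 * q ^+ 2 + q + 1)) = 0 by rewrite q4 subrr mulr0.
lra.
Qed.

(** The two points are mirror images; written relative to [c] and [q * c], the
    points of the cycle, their deviations are [c * (q - 1) * s ^ 2] up to
    sign. *)
Lemma few2_branch_point b : few_expansions q 2 b -> 1 <= q * b <= V ->
  b = c * (1 + (q - 1) * s ^+ 2) \/ b = q * c * (1 - (q - 1) * s ^+ 3).
Proof.
move=> fb /[dup] hb /(few2_branch q12 fb)[/(few_compl q12) fu fv].
have [|_ _ h] := few1_pair q12 second_base_lt fu fv.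
  by ring.
have bE : b = (1 + (q * b - 1)) / q by field.
rewrite bE.
have k5 : q ^+ 5 = 2 * q ^+ 3 + q ^+ 2 + q by rewrite exprS q4; ring.
case: h => ->; [right|left].
  apply: (mulfI (expf_neq0 2 qn0)); apply: (mulfI qqB0).
  rewrite [LHS](_ : _ = q * (q ^+ 2 - 1) + 1); last by field; rewrite qn0 qqB0.
  rewrite [RHS](_ : _ = q ^+ 3 - (q - 1)); last by field; rewrite qn0 qqB0.
  by ring.
apply: (mulfI (expf_neq0 4 qn0)); apply: (mulfI qqB0).
rewrite [LHS](_ : _ = q ^+ 3 * (q ^+ 2 - 1) + 1); last by field; rewrite qn0 qqB0.
rewrite [RHS](_ : _ = q ^+ 4 + (q - 1) * q ^+ 2); last by field; rewrite qn0 qqB0.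
by ring: k5 q4.
Qed.

(** The ratios to [c] of the points between [V - 1] and [q - 1] with at most two
    expansions. Pulling a branch point back along alternating digits divides its
    deviation from the cycle by [q] at each step; the sign, hence the parity of
    [j], tells which of the two branch points the orbit meets. *)
Definition few2_factor (l : R) :=
  l = 1 \/ exists j, l = 1 + (q - 1) * (- s) ^+ j.+2.

(** [orbit_trap] applied up to [q - 1], which separates the two branch points:
    only the smaller one can be met at an even time, only the larger one at an
    odd time. *)
Lemma few2_small v : few_expansions q 2 v -> 0 < v <= V - 1 ->
  exists m l, v = c * (s ^+ m.+1 * l) /\ few2_factor l.
Proof.
move=> fv vb.
have fm x : few_expansions q 2 x -> q * x < 1 -> few_expansions q 2 (q * x) by exact: few_mul.
have fB x : few_expansions q 2 x -> V < q * x -> few_expansions q 2 (q * x - 1) by exact: few_mulB.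
have qL := (golden_lt q12).1 second_base_golden.
have fl x : few_expansions q 2 x -> x <= V - 1 -> few_expansions q 2 (q * x).
  by move=> fx h; apply: fm => //; apply: le_lt_trans qL; rewrite ler_pM2l.
have [m [fp /andP[pl1 pl2]]] := scale_into q12 fl fv vb.
have d2 : q * (q - 1) <= V.
  rewrite -(ler_pM2r (_ : 0 < q - 1)) ?subr_gt0// mulVf//.
  by have := second_base_lt; lra.
have d0 : q * (V - 1) <= q - 1.
  rewrite hole_second.
  rewrite (_ : q * _ = c * (1 + s ^+ 2)); last by field; rewrite qn0 qqB0.
  rewrite mulrC ler_pdivrMr ?subr_gt0 ?exprn_egt1//.
  rewrite -(ler_pM2l (_ : 0 < q ^+ 2)) ?exprn_gt0//.
  rewrite (_ : q ^+ 2 * (1 + s ^+ 2) = q ^+ 2 + 1); last by field.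
  have k5 : q ^+ 5 = 2 * q ^+ 3 + q ^+ 2 + q by rewrite exprS q4; ring.
  have q2b : (53 / 31) ^+ 2 < q ^+ 2.
    by have := qb1; nra.
  suff : q ^+ 2 + 2 <= q ^+ 3 by have := q4; lra.
  by rewrite [q ^+ 3]exprS; have := qb1; nra.
have pd : V - 1 < q ^+ m.+1 * v <= q - 1 by rewrite pl1 (le_trans pl2).
have vE : v = s ^+ m.+1 * (q ^+ m.+1 * v) by rewrite exprVn mulKf// expf_neq0.
have qlt := ltW second_base_lt.
have [|[n [b [bE fb Sb bd]]]|[n [r [rE fb Sb rL]]]] :=
  orbit_trap q12 qlt second_base_golden (lexx _) d2 fm fB fp pd.
- by move=> pc; exists m, 1; split; [rewrite vE pc mulr1 mulrC|left].
- have pE : q ^+ m.+1 * v = c + s ^+ (2 * n) * (b - c).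
    by rewrite bE addrAC subrr add0r exprVn mulKf ?expf_neq0// subrKC.
  have [bE'|bE'] := few2_branch_point fb Sb.
    exists m, (1 + (q - 1) * (- s) ^+ (2 * n).+2); split; last by right; exists (2 * n)%N.
    rewrite vE pE bE' -[(2 * n).+2]addn2 exprD sqrrN [(- s) ^+ _]exprM sqrrN -exprM.
    by ring.
  exfalso; move: bd; rewrite leNgt => /negP[]; rewrite bE'.
  rewrite -(ltr_pM2l (_ : 0 < q ^+ 2 * (q ^+ 2 - 1))); last first.
    by rewrite mulr_gt0 ?exprn_gt0// subr_gt0 exprn_egt1.
  rewrite [ltRHS](_ : _ = q ^+ 3 - (q - 1)); last by field; rewrite qn0 qqB0.
  have k5 : q ^+ 5 = 2 * q ^+ 3 + q ^+ 2 + q by rewrite exprS q4; ring.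
  have := q2; have := q4; lra.
- have pE : q ^+ m.+1 * v = c + s ^+ (2 * n) * (r - c).
    by rewrite rE addrAC subrr add0r exprVn mulKf ?expf_neq0// subrKC.
  have [bE'|/(_ =P _)] := few2_branch_point fb Sb.
    exfalso; move: rL; rewrite ltNge => /negP[].
    rewrite -(ler_pM2l q0) bE' hole_second.
    rewrite [leRHS](_ : _ = c * (1 + s ^+ 2)); last by field; rewrite qn0 qqB0.
    by rewrite ler_pM2l// lerD2l ger_pMl ?exprn_gt0//; have := q2; lra.
  rewrite -mulrA => /eqP/(mulfI qn0) rE'.
  exists m, (1 + (q - 1) * (- s) ^+ (2 * n).+3); split; last by right; exists (2 * n).+1.
  rewrite vE pE rE' -[(2 * n).+3]addn3 exprD [(- s) ^+ (2 * n)]exprM sqrrN -exprM.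
  by ring.
Qed.

Let prod_bounds (x y a b a' b' : R) : 0 <= a -> 0 <= a' ->
  a <= x <= b -> a' <= y <= b' -> a * a' <= x * y /\ x * y <= b * b'.
Proof.
move=> a0 a'0 /andP[ax xb] /andP[ay yb]; split; first exact: ler_pM.
by apply: ler_pM => //; [exact: le_trans ax|exact: le_trans ay].
Qed.

(** Fractions with small terms, close enough to the true values to keep the gaps
    used in [few2_pair]. *)
Lemma inv_second_bounds :
  [/\ 45 / 77 <= s <= 31 / 53,
      14 / 41 <= s ^+ 2 <= 12 / 35,
      1 / 6 <= s ^+ 3 <= 15 / 74 & 1 / 9 <= s ^+ 4 <= 2 / 17] /\
  (0 <= s ^+ 5 <= 1 / 14 /\ 0 <= s ^+ 6 <= 1 / 24).
Proof.
have p1 := qb1; have p2 := qb2; have sq : s * q = 1 by rewrite mulVf.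
have sp := s0.
have sb : 45 / 77 <= s <= 31 / 53 by apply/andP; split; nra.
have [||h1 h2] := prod_bounds _ _ sb sb; [by rewrite ?divr_ge0|by rewrite ?divr_ge0|].
have b2 : 14 / 41 <= s ^+ 2 <= 12 / 35 by apply/andP; split; lra.
clear h1 h2; have [||h3 h4] := prod_bounds _ _ sb b2; [by rewrite ?divr_ge0|by rewrite ?divr_ge0|].
have b3 : 1 / 6 <= s ^+ 3 <= 15 / 74 by apply/andP; split; lra.
clear h3 h4; have [||h5 h6] := prod_bounds _ _ b2 b2; [by rewrite ?divr_ge0|by rewrite ?divr_ge0|].
have [||h7 h8] := prod_bounds _ _ b3 b2; [by rewrite ?divr_ge0|by rewrite ?divr_ge0|].
have [||h9 h0] := prod_bounds _ _ b3 b3; [by rewrite ?divr_ge0|by rewrite ?divr_ge0|].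
split; split => //; apply/andP; split; lra.
Qed.

(** The three ranges contain the factors with exponent 2, with exponent 4, and
    all the others. *)
Lemma few2_factor_bounds l : few2_factor l ->
  [\/ l = 1 + (q - 1) * s ^+ 2 /\ 31 / 25 <= l <= 5 / 4,
      14 / 13 <= l <= 25 / 23 |
      41 / 48 <= l <= 34 / 33].
Proof.
have [[_ b2 b3 b4] [b5 b6]] := inv_second_bounds.
have qb : 22 / 31 <= q - 1 <= 32 / 45.
  by have := qb1; have := qb2; move=> *; apply/andP; split; lra.
case=> [->|[j ->]]; first by apply: Or33; clear b2 b3 b4 b5 b6 qb; apply/andP; split; lra.
case: j => [|[|[|[|j]]]].
- have [||l2 h2] := prod_bounds _ _ qb b2; [by rewrite ?divr_ge0|by rewrite ?divr_ge0|]; move: l2 h2; clear b2 b3 b4 b5 b6 qb.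
  by move=> ? ?; apply: Or31; rewrite sqrrN; split=> //; apply/andP; split; lra.
- have [||l3 h3] := prod_bounds _ _ qb b3; [by rewrite ?divr_ge0|by rewrite ?divr_ge0|]; move: l3 h3; clear b2 b3 b4 b5 b6 qb.
  move=> ? ?; apply: Or33; rewrite exprNn -signr_odd /= expr1 mulN1r mulrN.
  by apply/andP; split; lra.
- have [||l4 h4] := prod_bounds _ _ qb b4; [by rewrite ?divr_ge0|by rewrite ?divr_ge0|]; move: l4 h4; clear b2 b3 b4 b5 b6 qb.
  move=> ? ?; apply: Or32; rewrite exprNn -signr_odd /= expr0 mul1r.
  by apply/andP; split; lra.
- have [||l5 h5] := prod_bounds _ _ qb b5; [by rewrite ?divr_ge0|by rewrite ?divr_ge0|]; move: l5 h5; clear b2 b3 b4 b5 b6 qb.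
  move=> ? ?; apply: Or33; rewrite exprNn -signr_odd /= expr1 mulN1r mulrN.
  by apply/andP; split; lra.
apply: Or33; have : `|(q - 1) * (- s) ^+ j.+4.+2| <= (q - 1) * s ^+ 6.
  rewrite normrM normrX normrN !gtr0_norm ?subr_gt0// ler_pM2l ?subr_gt0//.
  by apply: ler_wiXn2l; rewrite ?ltW.
have [||_ h6] := prod_bounds _ _ qb b6; [by rewrite ?divr_ge0|by rewrite ?divr_ge0|]; move: h6; clear b2 b3 b4 b5 b6 qb.
by move=> ?; rewrite ler_norml => /andP[? ?]; apply/andP; split; lra.
Qed.

(** A parity argument: the deviations from 1 of the two factors, unless
    zero, would be equal powers of [- s] with opposite signs. *)
Lemma few2_factor_ratio l l' : few2_factor l -> few2_factor l' ->
  l + s ^+ 2 * l' = 1 + s ^+ 2 -> l = 1 /\ l' = 1.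
Proof.
move=> hl hl' H.
have sn0 : s != 0 by rewrite invr_neq0.
have {}H : l - 1 = - (s ^+ 2 * (l' - 1)) by lra.
case: hl' => [l1|[j' lj']].
  by move/eqP: H; rewrite l1 subrr mulr0 oppr0 subr_eq0 => /eqP.
exfalso; case: hl => [l1|[j lj]].
  move/eqP: H; rewrite l1 subrr lj' [1 + _]addrC addrK eq_sym oppr_eq0.
  by apply/negP; apply: mulf_neq0; [|apply: mulf_neq0]; rewrite ?expf_neq0 ?oppr_eq0.
move: H; rewrite lj lj' ![1 + _]addrC !addrK [s ^+ 2 * _]mulrCA -mulrN => /(mulfI qB0).
rewrite -[s ^+ 2]sqrrN -exprD => H.
have ej : j.+2 = (2 + j'.+2)%N.
  have := congr1 Num.norm H; rewrite normrN !normrX normrN gtr0_norm//.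
  by apply: ieexprIn => //; rewrite lt_eqF.
move/eqP: H; rewrite ej -addr_eq0 -mulr2n mulrn_eq0 => /orP[//|].
by rewrite expf_eq0 oppr_eq0 (negPf sn0) andbF.
Qed.

(** After division by [s], the left side is too large for [m = 0] and
    [n <= 1] and too small for [m >= 1] and [n >= 2] or for [m = 0] and
    [n >= 5]. The case [m = 0, n = 2] is [few2_factor_ratio]; in the remaining
    ones the gaps between the possible factors decide. *)
Lemma few2_pair m n l l' : (m <= n)%N -> few2_factor l -> few2_factor l' ->
  s ^+ m.+1 * l + s ^+ n.+1 * l' = s + s ^+ 3 -> l = 1 /\ l' = 1.
Proof.
move=> mn hl hl' H.
have [[sb b2 b3 b4] [b5 _]] := inv_second_bounds.
have p1 := qb1; have p2 := qb2.
have sn0 : s != 0 by rewrite invr_neq0.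
have tail i j (a b : R) : a <= s ^+ i <= b -> (i <= j)%N -> 0 <= s ^+ j <= b.
  move=> /andP[_ h] ij; rewrite exprn_ge0 ?(ltW s0)//=; apply: le_trans h.
  by apply: ler_wiXn2l; rewrite ?ltW.
have {}sb : 45 / 77 <= s ^+ 1 <= 31 / 53 by rewrite expr1.
have rough x : few2_factor x -> 41 / 48 <= x <= 5 / 4.
  clear sb b2 b3 b4 b5 p1 p2 H.
  by case/few2_factor_bounds => [[_]||] /andP[? ?]; apply/andP; split; lra.
have bl := few2_factor_bounds hl; have rl := rough _ hl.
have bl' := few2_factor_bounds hl'; have rl' := rough _ hl'.
have mulb (x a b : R) : 0 <= a -> a <= x <= b ->
    a * (41 / 48) <= x * l' /\ x * l' <= b * (5 / 4).
  by move=> a0 xb; apply: (prod_bounds a0 _ xb rl'); rewrite divr_ge0.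
have {}H : s ^+ m * l + s ^+ n * l' = 1 + s ^+ 2.
  apply: (mulfI sn0); rewrite mulrDr !mulrA -!exprS H; ring.
case: m mn H => [|m] mn H.
  rewrite expr0 mul1r in H; case: n mn H => [|[|[|[|[|n]]]]] _ H.
  - by exfalso; rewrite expr0 mul1r in H; clear sb b3 b4 b5 p1 p2 bl bl'; lra.
  - exfalso.
    by have [|? ?] := mulb _ _ _ _ sb; [by rewrite divr_ge0|];
      clear b3 b4 b5 p1 p2 bl bl' rl'; lra.
  - exact: few2_factor_ratio H.
  - exfalso; have [|? ?] := mulb _ _ _ _ b3; [by rewrite divr_ge0|];
      clear b4 b5 bl' sb p1 p2 rl rl'.
    by case: bl => [[_]||] /andP[? ?]; lra.
  - exfalso; have [|? ?] := mulb _ _ _ _ b4; [by rewrite divr_ge0|].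
    clear sb b3 b4 b5 bl' rl rl'.
    case: bl => [[lE _]|/andP[? ?]|/andP[? ?]]; [|lra|lra].
    (* for the largest factor, substitute its exact value: the equation then
       becomes s ^ 2 * l' = 2 - q *)
    have [|l2 _] := mulb _ _ _ _ b2; [by rewrite divr_ge0|].
    have : s ^+ 2 * (s ^+ 2 * l' - (2 - q)) = 0.
      by rewrite mulrBr mulrA -exprD; clear b2 l2 p1 p2; move: H; rewrite lE; lra.
    move/eqP; rewrite mulf_eq0 expf_eq0 (negPf sn0) andbF/= subr_eq0 => /eqP.
    lra.
  - exfalso.
    by have [|? ?] := mulb _ _ _ _ (tail 5%N n.+1.+4 _ _ b5 isT);
      [exact: lexx|clear sb b3 b4 b5 p1 p2 bl bl' rl'; lra].
case: n mn H => [//|n] mn H; exfalso.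
case: n mn H => [|n] mn H.
  case: m mn H => [|//] mn H.
  have {}H : l + l' = q + s.
    apply: (mulfI sn0); rewrite mulrDr -[in LHS](expr1 s) H.
    by rewrite mulrDr mulVf// expr2.
  clear b2 b3 b4 b5 rl rl'.
  by case: bl => [[_]||] /andP[? ?]; case: bl' => [[_]||] /andP[? ?]; lra.
have [|? ?] := mulb _ _ _ _ (tail 2%N n.+2 _ _ b2 isT); [exact: lexx|].
have [||? ?] := prod_bounds _ _ (tail 1%N m.+1 _ _ sb isT) rl; [exact: lexx|by rewrite divr_ge0|].
by clear sb b3 b4 b5 p1 p2 bl bl' rl rl'; lra.
Qed.

Lemma few2_factor_lt m l : few2_factor l -> s ^+ m.+1 * l < s + s ^+ 3.
Proof.
move=> hl; have [[_ b2 _ _] _] := inv_second_bounds.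
have [l0 l1] : 0 <= l /\ l <= 5 / 4.
  by case/few2_factor_bounds: hl => [[_]||] /andP[? ?]; split; lra.
apply: (le_lt_trans (_ : _ <= s * (5 / 4))).
  apply: ler_pM => //; first by rewrite exprn_ge0// ltW.
  by rewrite exprS ger_pMr// exprn_ile1// ltW.
rewrite (_ : s + s ^+ 3 = s * (1 + s ^+ 2)); last by ring.
by rewrite ltr_pM2l//; lra.
Qed.

(** In the base of the points with exactly two expansions, the children of a
    branch point cannot have one and two, or two and two, expansions. *)
Lemma few2_pair_unique u v a b : E u #= `I_a -> E v #= `I_b ->
  (0 < a <= 2)%N -> (0 < b <= 2)%N -> u + v = V - 1 -> a = 1%N /\ b = 1%N.
Proof.
move=> Eu Ev ha hb uv.
have fu : few_expansions q 2 u by exists a.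
have fv : few_expansions q 2 v by exists b.
have /andP[u0 _] := few_in q12 fu; have /andP[v0 _] := few_in q12 fv.
have nz w w' : few_expansions q 2 w' -> 0 <= w -> w + w' = V - 1 -> 0 < w' -> 0 < w.
  move=> fw'; rewrite le_eqVlt => /orP[/eqP <-|//]; rewrite add0r => w'E w'0.
  have [|m [l [+ hl]]] := few2_small fw'; first by rewrite w'0 w'E lexx.
  rewrite w'E hole_second => /(mulfI (lt0r_neq0 c0)) h.
  by have := few2_factor_lt m hl; rewrite -h ltxx.
have L0 : 0 < V - 1.
  by rewrite hole_second mulr_gt0// addr_gt0// exprn_gt0.
have [up vp] : 0 < u /\ 0 < v.
  have [vp|v'] := ltP 0 v; first by split=> //; exact: (nz u v).
  have v'0 : v = 0 by lra.
  by have := nz v u fu v0 ltac:(lra) ltac:(lra); lra.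
have [|m [l [uE hl]]] := few2_small fu; first by apply/andP; split; lra.
have [|n [l' [vE hl']]] := few2_small fv; first by apply/andP; split; lra.
have H : s ^+ m.+1 * l + s ^+ n.+1 * l' = s + s ^+ 3.
  by apply: (mulfI (lt0r_neq0 c0)); rewrite mulrDr -uE -vE uv hole_second.
have [l1 l'1] : l = 1 /\ l' = 1.
  have [mn|/ltnW nm] := leqP m n; first exact: few2_pair H.
  by rewrite addrC in H; have [-> ->] := few2_pair nm hl' hl H.
have := card_cycle_shift q12 m.+1 second_base_golden.
have := card_cycle_shift q12 n.+1 second_base_golden.
move: uE vE; rewrite l1 l'1 !mulr1 => <- <- Ev' Eu'.
by rewrite (card_expansions_uniq Eu Eu') (card_expansions_uniq Ev Ev').
Qed.

End second_base.

(** * Points with k expansions in the threshold base *)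

Section threshold_base.
Variables (R : realType) (q : R).
Hypothesis q12 : 1 < q < 2.
Hypothesis qf : q_f_eq q.
Hypothesis qG : q + 1 < q ^+ 2.
Local Notation E := (q_expansions q).
Local Notation V := ((q - 1)^-1).
Local Notation c := ((q ^+ 2 - 1)^-1).
Local Notation s := (q^-1).

Let q1 : 1 < q. Proof. by case/andP: q12. Qed.
Let q2 : q < 2. Proof. by case/andP: q12. Qed.
Let q0 : 0 < q. Proof. exact: lt_trans ltr01 q1. Qed.
Let qn0 : q != 0. Proof. by rewrite gt_eqF. Qed.
Let qB0 : q - 1 != 0. Proof. by rewrite subr_eq0 gt_eqF. Qed.
Let qqB0 : q ^+ 2 - 1 != 0. Proof. by rewrite subr_eq0 gt_eqF// exprn_egt1. Qed.
Let c0 : 0 < c. Proof. by rewrite invr_gt0 subr_gt0 exprn_egt1. Qed.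
Let s0 : 0 < s. Proof. by rewrite invr_gt0. Qed.
Let s1 : s < 1. Proof. by rewrite invf_lt1. Qed.

Lemma threshold_hole : V = 1 + s ^+ 2.
Proof.
apply: (mulfI (expf_neq0 2 qn0)); apply: (mulfI qB0).
rewrite [LHS](_ : _ = q ^+ 2); last by field.
rewrite [RHS](_ : _ = (q - 1) * (q ^+ 2 + 1)); last by field.
by have := qf; rewrite /q_f_eq; lra.
Qed.

(** The defining equation of [q_f], read as the expansion 1101 of 1. *)
Lemma threshold_one : 1 = s + s ^+ 2 + s ^+ 4.
Proof.
apply: (mulfI (expf_neq0 4 qn0)).
rewrite [RHS](_ : _ = q ^+ 3 + q ^+ 2 + 1); last by field.
by rewrite mulr1 exprS; have := qf; rewrite /q_f_eq => h; rewrite h; ring: h.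
Qed.

(** The point with digits [1 (0000)^j (01)^oo]. *)
Definition ladder (j : nat) : R := s + c * s ^+ (4 * j).+1.

Lemma ladder_gt j : s < ladder j.
Proof. by rewrite ltrDl mulr_gt0// exprn_gt0. Qed.

Lemma ladder_lt1 j : ladder j < 1.
Proof.
apply: (le_lt_trans (_ : _ <= s + c * s)).
  by rewrite lerD2l ler_pM2l// exprS ger_pMr// exprn_ile1// ltW.
rewrite (_ : s + c * s = q / (q ^+ 2 - 1)); last by field; rewrite qn0 qqB0.
by rewrite ltr_pdivrMr ?subr_gt0 ?exprn_egt1// mul1r ltrBrDr.
Qed.

Lemma card_lift0 x k : E x #= `I_k -> x < 1 -> E (x / q) #= `I_k.
Proof.
move=> Ex x1; have xq : q * (x / q) = x by rewrite mulrC divfK.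
rewrite -[k]addn0; apply: (card_expansionsD q12); rewrite xq//.
by apply: (card_expansions_out q12); rewrite negb_and -ltNge subr_lt0 x1.
Qed.

Lemma card_lift1 x k : E x #= `I_k -> V - 1 < x -> E ((x + 1) / q) #= `I_k.
Proof.
move=> Ex x1; have xq : q * ((x + 1) / q) = x + 1 by rewrite mulrC divfK.
rewrite -[k]add0n; apply: (card_expansionsD q12); rewrite xq ?addrK//.
by apply: (card_expansions_out q12); rewrite negb_and -!ltNge -ltrBlDr x1 orbT.
Qed.

(** Reading 1 as the first digit leaves a univoque point. Reading 0 instead
    leaves, by [threshold_one], the forced digits 110 followed by the previous
    rung. Hence each rung has one expansion more than the previous one. *)
Lemma card_ladder j : E (ladder j) #= `I_j.+1.
Proof.
have tailE i : q * ladder i - 1 = c * s ^+ (4 * i).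
  by rewrite /ladder mulrDr mulfV// [s ^+ _.+1]exprS mulrCA mulVKf// addrAC subrr add0r.
have tail1 i : E (q * ladder i - 1) #= `I_1.
  by rewrite tailE; exact: card_cycle_shift.
elim: j => [|j ih].
  rewrite -[1%N]add0n; apply: (card_expansionsD q12) => //.
  apply: (card_expansions_out q12); rewrite negb_and -!ltNge; apply/orP; right.
  rewrite -(ltrD2r (-1)) tailE muln0 expr0 mulr1 hole_cycle// gtr_pMr//; move: qG; lra.
suff h : E (q * ladder j.+1) #= `I_j.+1.
  by rewrite -[j.+2]addn1; exact: (card_expansionsD q12 h (tail1 _)).
(* the digits 1 0000 of the rung are replaced by 0 1101 *)
rewrite (_ : q * _ = ((ladder j / q + 1) / q + 1) / q); last first.
  have -> : ladder j.+1 = s + s ^+ 4 * (ladder j - s).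
    by rewrite /ladder mulnS -addnS exprD; ring.
  have -> : q * (s + s ^+ 4 * (ladder j - s)) = 1 + s ^+ 3 * (ladder j - s).
    by field.
  rewrite {1}threshold_one; field.
  by [].
have h1 : V - 1 < ladder j / q.
  by rewrite threshold_hole addrAC subrr add0r expr2 ltr_pM2r// ladder_gt.
apply: card_lift1; first by apply: card_lift1 h1; apply: card_lift0 ih (ladder_lt1 j).
rewrite threshold_hole addrAC subrr add0r expr2 ltr_pM2r//.
by apply: (lt_trans s1); rewrite ltrDr divr_gt0// (lt_trans s0)// ladder_gt.
Qed.

End threshold_base.

(** * The smallest base *)

Theorem theorem1p2 (R : realType) (k : nat) (hk : (3 <= k)%N) :
  calB R k (q_f R) /\ (forall q : R, calB R k q -> q_f R <= q).
Proof.
have fP := q_fP R; set f := q_f R in fP *.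
have [f1 f2] : 7 / 4 <= f /\ f < 2.
  by have /andP[h1 h2] := q_f_approx R; split; rewrite /f; lra.
have f12 : 1 < f < 2 by apply/andP; split; lra.
have fG : f + 1 < f ^+ 2 by nra.
split.
  split=> //; exists (ladder f k.-1).
  have Ek := card_ladder f12 fP fG k.-1.
  rewrite prednK in Ek; last exact: leq_trans hk.
  split; last exact: Ek.
  have f0 : 0 < f by lra.
  have := ladder_gt f12 k.-1; have := ladder_lt1 f12 fG k.-1.
  have : 0 < f^-1 by rewrite invr_gt0.
  have : 1 < (f - 1)^-1 by rewrite invf_gt1; lra.
  by move=> h1 h2 h3 h4; apply/andP; split; lra.
move=> q [q12 [x [_ Ex]]]; rewrite leNgt; apply/negP => qf.
have /andP[q1 q2] := q12.
have qlt : q ^+ 3 < 2 * q ^+ 2 - q + 1.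
  have h : (q - 1) ^+ 2 <= (f - 1) ^+ 2 by rewrite lerXn2r ?nnegrE; lra.
  move: fP; rewrite /q_f_eq => fP.
  nra.
have pairE z : (q - 1)^-1 - q * z + (q * z - 1) = (q - 1)^-1 - 1 by ring.
have [z [a [b [ha hb hab Ea Eb]]]] :=
  branch_point_small q12 (ltnW hk) Ex.
have Ea' := card_expansions_compl q12 Ea.
have q4 : q ^+ 4 = 2 * q ^+ 2 + q + 1.
  have [y [n [hn Ey]]] : exists y n, n = 2%N /\ q_expansions q y #= `I_n.
    have [a2|b2] : a = 2%N \/ b = 2%N.
      by move: ha hb hab hk; clear; lia.
    - by exists (q * z), a.
    - by exists (q * z - 1), b.
  subst n.
  have [//|z' [a' [b' [ha' hb' hab' Ea2 Eb2]]]] := branch_point_small q12 _ Ey.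
  have [a1 b1] : a' = 1%N /\ b' = 1%N by move: ha' hb' hab'; clear; lia.
  subst a' b'.
  have fu : few_expansions q 1 ((q - 1)^-1 - q * z').
    exists 1%N; [by []|exact: (card_expansions_compl q12 Ea2)].
  have fv : few_expansions q 1 (q * z' - 1) by exists 1%N; [|exact: Eb2].
  by have [] := few1_pair q12 qlt fu fv (pairE z').
have [a1 b1] := few2_pair_unique q12 q4 Ea' Eb ha hb (pairE z).
by move: hab; rewrite a1 b1 (minn_idPr hk).
Qed.
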